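(* Let $q$ be an odd prime and let $C$ be a linear $(n,k+1,q)$-MDS code over $GF(q)$ with $n>\frac23(q-1)+k$. Let $S$ be the collection of codes consisting of $C$ and all (linear or non-linear) extensions of $C$. Then: (i) all members of $S$ are LE codes; and (ii) there is, up to equivalence, a unique maximal code in $S$.
   Context: An $(n,k,q)$-MDS code over an alphabet $\mathcal A$ of size $q$ is a set of $q^k$ $n$-tuples (words) over $\mathcal A$ such that no two distinct words agree in $k$ or more coordinate positions. It is linear if $\mathcal A=GF(q)$ and the code is a $k$-dimensional subspace of $GF(q)^n$. An $(m,k,q)$-MDS code $C'$ with $m>n$ (over the same alphabet) is an extension of the $(n,k,q)$-MDS code $C$ if deleting some fixed set of $m-n$ coordinate positions from every word of $C'$ yields $C$. An MDS code is maximal if it admits no extensions. Two codes of length $n$ over $\mathcal A$, viewed as matrices whose rows are the words, are equivalent if one is obtained from the other by a sequence of operations of the types: permuting rows; permuting columns; applying a permutation of the alphabet entrywise to a single column. A code is an LE code if it is equivalent to a linear code.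
   Formalization: Part (ii) is stated for k ≥ 1 only: when k = 0 the code C is a repetition-type code that can be extended indefinitely, so S contains no maximal code and (ii) fails; part (i) is stated for all k ≥ 0. *)

(* Defs.v *)
From HB Require Import structures.
From mathcomp Require Import all_boot all_order all_algebra all_fingroup.

Set Implicit Arguments.
Unset Strict Implicit.
Unset Printing Implicit Defensive.

Import GRing.Theory.
Local Open Scope ring_scope.

(* Words of length n over the alphabet A are row vectors 'rV[A]_n, and a code
   is a set of words.  The alphabet size q is #|A|, so it is not a separate
   parameter. *)

Definition is_mds (A : finType) (k n : nat) (C : {set 'rV[A]_n}) : Prop :=
  #|C| = (#|A| ^ k)%N /\
  (forall x y : 'rV[A]_n, x \in C -> y \in C -> x != y ->
     (#|[set i : 'I_n | x ord0 i == y ord0 i]| < k)%N).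

Definition is_linear (F : finFieldType) (k n : nat) (C : {set 'rV[F]_n}) : Prop :=
  exists V : {vspace 'rV[F]_n}, \dim V = k /\ C = [set w | w \in V].

(* The retained positions, in their original order, are given by a strictly
   increasing map f; the m - n deleted positions are those outside its range. *)
Definition is_extension (A : finType) (k n m : nat)
    (C : {set 'rV[A]_n}) (C' : {set 'rV[A]_m}) : Prop :=
  [/\ (n < m)%N,
      is_mds k C,
      is_mds k C' &
      exists f : 'I_n -> 'I_m,
        {homo f : i j / (i < j)%N} /\ C = [set colsub f w | w in C']].

Definition is_maximal (A : finType) (k n : nat) (C : {set 'rV[A]_n}) : Prop :=
  is_mds k C /\
  ~ exists (m : nat) (C' : {set 'rV[A]_m}), is_extension k C C'.

Definition relabel (A : finType) (n : nat) (j : 'I_n) (p : {perm A})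
    (w : 'rV[A]_n) : 'rV[A]_n :=
  \row_i (if i == j then p (w ord0 i) else w ord0 i).

(* Permuting the rows of the matrix of a code leaves its set of words
   unchanged, so only the two column operations appear.  The length of the
   second code is an index so that codes not known in advance to have the same
   length can be compared; equivalent codes do have the same length. *)
Inductive equivalent (A : finType) (n : nat) (C : {set 'rV[A]_n}) :
    forall m : nat, {set 'rV[A]_m} -> Prop :=
| equivalent_refl : equivalent C C
| equivalent_col_perm (m : nat) (D : {set 'rV[A]_m}) (s : 'S_m) :
    equivalent C D -> equivalent C [set col_perm s w | w in D]
| equivalent_relabel (m : nat) (D : {set 'rV[A]_m}) (j : 'I_m) (p : {perm A}) :
    equivalent C D -> equivalent C [set relabel j p w | w in D].

Definition is_LE (F : finFieldType) (k n : nat) (C : {set 'rV[F]_n}) : Prop :=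
  exists L : {set 'rV[F]_n}, is_linear k L /\ equivalent C L.

Inductive self_or_extension (A : finType) (k n : nat) (C : {set 'rV[A]_n}) :
    forall m : nat, {set 'rV[A]_m} -> Prop :=
| soe_self : self_or_extension k C C
| soe_extension (m : nat) (C' : {set 'rV[A]_m}) :
    is_extension k C C' -> self_or_extension k C C'.

(* Main.v *)
Require Import Defs.
From mathcomp Require Import all_boot all_order all_algebra all_fingroup.
From mathcomp Require Import all_field zify ring lra.

Set Implicit Arguments.
Unset Strict Implicit.
Unset Printing Implicit Defensive.

Import Order.TTheory GRing.Theory Num.Theory.
Local Open Scope ring_scope.

(** A linear [(n,k+1,q)]-MDS code is the set of words [u *m A], where the
    columns of [A] form an arc: a nonzero [u] annihilates at most [k] of them.
    In an extension, a new coordinate is a function [phi] of [u].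

    (i) Each [phi] is a linear form followed by a permutation of the alphabet
    ([extension_coordinate_linear]).  Fixing [k - 1] of [k + 1] independent
    coordinates cuts out an affine plane, in which a level set of [phi] is the
    graph of a function [f] on the prime field such that [f + c id] is injective
    for [n - k > 2/3 (q - 1)] values of [c].  By the power sums of [f + c id],
    such an [f] is affine ([affine_of_few_directions]): the low moments
    [\sum_t t^i f(t)^m] vanish, which bounds the degree [d] of [f] by [(q-1)/3],
    and then, if [d > 1], contradicts the value of the moment for which
    [i + m d = q - 1].  The slope of [f] is never zero; being itself affine in
    each of the fixed coordinates, it does not depend on them
    ([affine_of_axes]), so the level sets are hyperplanes, and they are parallel
    because they are disjoint.  Undoing the permutations coordinate by
    coordinate turns the extension into a linear code.

    (ii) By (i), an extension is given, up to relabelling, by an arc that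
    contains the columns of [A].  The heart of the matter is that two
    non-proportional columns [P] and [a], each of which extends a large arc,
    extend it together ([ext_on_setU1]).  If they do not, then [P], [a] and some
    column of the arc become collinear after projection from [k - 2] other
    columns to a plane.  When that line is taken as the line at infinity, the
    remaining columns of the arc become affine points, no three of them
    collinear, with distinct values of [x], of [y] and of [x + y];
    [no_planar_configuration] bounds their number by [2q/3].  Its proof follows
    Segre's lemma of tangents.  Hence a longest arc containing the columns of
    [A] contains, up to scalars, every column that extends [A].  It gives a
    maximal code, and any other maximal code uses the same columns up to order
    and scalars. *)

(** * Power sums over a finite field *)

Section FiniteField.
Variable F : finFieldType.

Lemma natr_card_finField : #|F|%:R = 0 :> F.
Proof.
have E : \sum_(x : F) x = \sum_(x : F) x + #|F|%:R.
  rewrite {1}(reindex_inj (addIr 1)) /= big_split /=; congr (_ + _).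
  by rewrite sumr_const cardT enumT.
by apply: (addrI (\sum_(x : F) x)); rewrite addr0 -E.
Qed.

Lemma expf_card_pred (x : F) : x != 0 -> x ^+ #|F|.-1 = 1.
Proof.
move=> x0; apply: (mulfI x0); rewrite mulr1 -exprS prednK ?expf_card //.
exact: ltnW (finNzRing_gt1 F).
Qed.

Lemma sum_expf_small j : (0 < j < #|F|.-1)%N -> \sum_(x : F) x ^+ j = 0.
Proof.
case/andP=> j0 jq.
have [g g0 gj] : exists2 g : F, g != 0 & g ^+ j != 1.
  apply/exists_inP; apply: contraLR jq => /exists_inPn H.
  pose Z := [set x : F | x != 0].
  have cZ : #|Z| = #|F|.-1.
    have -> : Z = ~: [set 0] by apply/setP=> x; rewrite !inE.
    by rewrite cardsC1.
  have := @max_poly_roots _ ('X^j - 1 : {poly F}) (enum Z).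
  rewrite -cardE cZ size_XnsubC // -leqNgt ltnS; apply.
  - by rewrite -size_poly_eq0 size_XnsubC.
  - apply/allP=> x; rewrite mem_enum inE => x0.
    by rewrite rootE !hornerE subr_eq0; have := H x x0; rewrite negbK.
  - exact: enum_uniq.
have E : \sum_(x : F) x ^+ j = g ^+ j * \sum_(x : F) x ^+ j.
  rewrite {1}(reindex_inj (mulfI g0)) /= mulr_sumr.
  by apply: eq_bigr => x _; rewrite exprMn.
apply/eqP; have /eqP : (1 - g ^+ j) * \sum_(x : F) x ^+ j = 0.
  by rewrite mulrBl mul1r -E subrr.
by rewrite mulf_eq0 subr_eq0 eq_sym (negbTE gj).
Qed.

Lemma sum_expf_pred : \sum_(x : F) x ^+ #|F|.-1 = -1.
Proof.
rewrite (bigD1 0) //= expr0n.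
have -> : (#|F|.-1 == 0)%N = false by case: #|F| (finNzRing_gt1 F) => [|[|]].
rewrite add0r (eq_bigr (fun=> 1)); last by move=> x; apply: expf_card_pred.
rewrite sumr_const; have -> : #|[pred x : F | x != 0]| = #|F|.-1.
  have -> : #|[pred x : F | x != 0]| = #|predC1 (0 : F)| by apply: eq_card.
  by rewrite cardC1.
have := natr_card_finField; rewrite -{1}(@prednK #|F|).
  by rewrite mulrS => /eqP; rewrite addrC addr_eq0 => /eqP.
exact: ltnW (finNzRing_gt1 F).
Qed.

Lemma sum_horner_finField (p : {poly F}) :
  (size p <= #|F|)%N -> \sum_(x : F) p.[x] = - p`_(#|F|.-1).
Proof.
have q1 : (1 < #|F|)%N := finNzRing_gt1 F.
move=> sp; under eq_bigr => x _ do rewrite (horner_coef_wide x sp).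
rewrite exchange_big /=.
under eq_bigr => i _ do rewrite -mulr_sumr.
have lq : (#|F|.-1 < #|F|)%N by lia.
rewrite (bigD1 (Ordinal lq)) //= sum_expf_pred mulrN1 big1 ?addr0 // => i.
rewrite -val_eqE /= => ne; case: (posnP i) => [->|i0].
  under eq_bigr => x _ do rewrite expr0.
  by rewrite sumr_const cardT /= -cardT natr_card_finField mulr0.
have iq : (i <= #|F|.-1)%N by rewrite -ltnS prednK // ltnW.
by rewrite sum_expf_small ?mulr0 // i0 ltn_neqAle ne.
Qed.

Lemma poly_of_fun (f : F -> F) :
  exists2 p : {poly F}, (size p <= #|F|)%N & forall x, p.[x] = f x.
Proof.
have q1 : (1 < #|F|)%N := finNzRing_gt1 F.
exists (\sum_a f a *: (1 - ('X - a%:P) ^+ #|F|.-1)).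
  apply: (leq_trans (size_sum _ _ _)); apply/bigmax_leqP => a _.
  apply: (leq_trans (size_scale_leq _ _)).
  apply: (leq_trans (size_polyD _ _)).
  by rewrite size_poly1 size_polyN size_exp_XsubC geq_max; lia.
move=> x; rewrite horner_sum (bigD1 x) //= !hornerE subrr expr0n.
have -> : (#|F|.-1 == 0)%N = false by case: #|F| q1 => [|[|]].
rewrite subr0 mulr1 big1 ?addr0 // => a ax; rewrite !hornerE.
by rewrite expf_card_pred ?subrr ?mulr0 // subr_eq0 eq_sym.
Qed.

(** Wilson's theorem for finite fields: both sides are the derivative of
    [X^q - X] at [a]. *)
Lemma prod_subf_neq (a : F) : \prod_(t | t != a) (a - t) = -1.
Proof.
have := congr1 (fun p => p^`().[a]) (finField_genPoly F).
rewrite (bigD1 a) //= derivM !derivE !hornerE subrr mul0r addr0.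
rewrite horner_prod => H.
rewrite (eq_bigr (fun t => ('X - t%:P).[a])); last by move=> t _; rewrite !hornerE.
by rewrite -H hornerMn -mulr_natr natr_card_finField mulr0 add0r.
Qed.

End FiniteField.

(** * Functions on a prime field that determine few directions *)

(** For each [c] in [S] the sum of [(f t + c t)^(i+m)] over [t] is a power sum
    of the whole field, hence zero.  As a polynomial in [c] it has degree less
    than [i + m], because [\sum_t t^(i+m)] is zero as well; so it is the zero
    polynomial when [S] has at least [i + m] elements. *)
Lemma moments_vanish (p : nat) (f : 'F_p -> 'F_p) (S : {set 'F_p}) :
  prime p ->
  {in S, forall c, injective (fun t => f t + c * t)} ->
  forall i m, (0 < m)%N -> (i + m <= #|S|)%N -> (i + m < p.-1)%N ->
  \sum_t t ^+ i * f t ^+ m = 0.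
Proof.
move=> p_pr injS i m m0 imS imp; set j := (i + m)%N in imS imp.
have cF := card_Fp p_pr.
pose M e := \sum_t t ^+ e * f t ^+ (j - e).
have Mj : M j = 0.
  rewrite /M subnn; under eq_bigr => t _ do rewrite expr0 mulr1.
  by apply: sum_expf_small; rewrite cF; lia.
pose Q := \poly_(e < j) (M e *+ 'C(j, e)).
have Q0 : Q = 0.
  apply: (@roots_geq_poly_eq0 _ Q (enum S)); last first.
  - by rewrite -cardE; apply: leq_trans (size_poly _ _) imS.
  - exact: enum_uniq.
  apply/allP=> c; rewrite mem_enum => cS; apply/eqP.
  have : \sum_t (f t + c * t) ^+ j = 0.
    rewrite -(reindex_inj (injS c cS) (P := predT) (F := fun y => y ^+ j)) /=.
    by apply: sum_expf_small; rewrite cF; lia.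
  under eq_bigr => t _ do rewrite exprDn.
  rewrite exchange_big /= big_ord_recr /= => H.
  rewrite horner_poly -[RHS]H.
  have -> : \sum_t f t ^+ (j - j) * (c * t) ^+ j *+ 'C(j, j) = 0.
    rewrite binn subnn.
    under eq_bigr => t _ do rewrite expr0 mul1r mulr1n exprMn.
    rewrite -mulr_sumr sum_expf_small ?mulr0 // cF; lia.
  rewrite addr0; apply: eq_bigr => e _.
  rewrite sumrMnl mulrnAl; congr (_ *+ _); rewrite /M mulr_suml.
  by apply: eq_bigr => t _; rewrite exprMn; ring.
have := congr1 (fun r : {poly _} => r`_i) Q0.
rewrite coef_poly coef0 {1}/j -{1}[i]addn0 ltn_add2l m0 => /eqP.
rewrite -mulr_natr mulf_eq0 => /orP[/eqP|].
  by rewrite /M /j addKn.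
rewrite -(dvdn_pcharf (pchar_Fp p_pr)) => pC.
have : (p %| j`!)%N by rewrite -(bin_fact (leq_addr m i)) dvdn_mulr.
have : (j < p)%N by lia.
elim: (j) => [|n IHn] np; first by rewrite dvdn1; rewrite (gtn_eqF (prime_gt1 p_pr)).
by rewrite factS Euclid_dvdM // gtnNdvd //= => /IHn; apply; apply: ltnW.
Qed.

(** The graph of [f] determines none of the directions [- c], [c] in [S].  This
    is a weak form, sufficient here, of the theorem of Redei, Megyesi and
    Lovasz-Schrijver. *)
Lemma affine_of_few_directions (p : nat) (f : 'F_p -> 'F_p) (S : {set 'F_p}) :
  prime p -> (2 * p.-1 < 3 * #|S|)%N ->
  {in S, forall c, injective (fun t => f t + c * t)} ->
  exists s, forall t, f t = f 0 + s * t.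
Proof.
move=> p_pr bigS injS; have cF := card_Fp p_pr.
have p1 := prime_gt1 p_pr.
(* [f] is a polynomial function; its degree [d] is to be shown at most 1 *)
have [P sP fP] := poly_of_fun f; rewrite cF in sP.
have mom := moments_vanish p_pr injS.
suff sP2 : (size P <= 2)%N.
  exists P`_1 => t; rewrite -!fP !(horner_coef_wide _ sP2) !big_ord_recr !big_ord0 /=.
  ring.
rewrite leqNgt; apply/negP => P2.
pose d := (size P).-1.
have dE : size P = d.+1 by rewrite /d; lia.
have P0 : P != 0 by rewrite -size_poly_gt0 dE.
(* [X^i P^m] then has degree [p - 1], so its power sum is not zero *)
have key i m : (0 < m)%N -> (i + d * m = p.-1)%N -> (i + m < p.-1)%N ->
    (#|S| < i + m)%N.
  move=> m0 deg imp; rewrite ltnNge; apply/negP => imS.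
  have Pm0 : P ^+ m != 0 by rewrite expf_neq0.
  have szm : size (P ^+ m) = (d * m).+1.
    by rewrite -(size_exp P m) prednK // size_poly_gt0.
  have sz : size (P ^+ m * 'X^i) = p by rewrite size_mulXn // szm; lia.
  have := sum_horner_finField (p := P ^+ m * 'X^i); rewrite cF sz => /(_ (leqnn _)).
  under eq_bigr => t _ do rewrite !hornerE fP mulrC.
  have <- : lead_coef (P ^+ m * 'X^i) = (P ^+ m * 'X^i)`_p.-1 by rewrite lead_coefE sz.
  rewrite mom // => /eqP; rewrite eq_sym oppr_eq0 lead_coef_eq0.
  by rewrite mulf_eq0 (negbTE Pm0) (negbTE (monic_neq0 (monicXn _ _))).
(* the moments of degree one in [f] bound the degree of [P] *)
have dS : (d + #|S| < p)%N.
  have [] := leqP p (d + #|S|)%N; last by [].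
  by move=> dS; have := key (p.-1 - d)%N 1%N isT; lia.
(* with [m] and [i] the quotient and remainder of [p - 1] by [d], [i + m] is
   too small for the moment not to vanish *)
have := divn_eq p.-1 d; set m := (p.-1 %/ d)%N; set i := (p.-1 %% d)%N => deg.
have id : (i < d)%N by rewrite ltn_mod; lia.
have m3 : (2 < m)%N by rewrite leq_divRL; lia.
have bnd : (3 * (i + m) <= 2 * p.-1)%N by nia.
have : (#|S| < i + m)%N by apply: key; lia.
lia.
Qed.

Lemma subset_of_card (T : finType) (A : {set T}) n : (n <= #|A|)%N ->
  exists2 B : {set T}, B \subset A & #|B| = n.
Proof.
move=> nA; exists [set x in take n (enum A)].
  by apply/subsetP=> x; rewrite inE => /mem_take; rewrite mem_enum.
rewrite cardsE (card_uniqP _) ?take_uniq ?enum_uniq // size_takel //.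
by rewrite -cardE.
Qed.

(** * Divided differences and complementary polynomials *)

Section Interpolation.
Variables (F : finFieldType) (T : finType).

Lemma size_prod_XsubC_set (I : finType) (E : {set I}) (a : I -> F) :
  size (\prod_(j in E) ('X - (a j)%:P)) = #|E|.+1.
Proof. by rewrite -big_enum size_prod_XsubC -cardE. Qed.

(** The leading coefficient of Lagrange's interpolation formula. *)
Lemma sum_divided_difference (E : {set T}) (a : T -> F) (p : {poly F}) :
  {in E &, injective a} -> (size p <= #|E|)%N ->
  \sum_(i in E) p.[a i] / \prod_(j in E :\ i) (a i - a j) = p`_(#|E|.-1).
Proof.
move=> inja sp.
pose L i := \prod_(j in E :\ i) ('X - (a j)%:P).
have sL i : i \in E -> size (L i) = #|E|.
  by move=> iE; rewrite size_prod_XsubC_set (cardsD1 i E) iE.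
have La i : (L i).[a i] = \prod_(j in E :\ i) (a i - a j).
  by rewrite horner_prod; apply: eq_bigr => j _; rewrite !hornerE.
have La0 i j : i \in E -> j \in E -> j != i -> (L i).[a j] = 0.
  move=> iE jE ji; rewrite horner_prod (bigD1 j) ?inE ?ji //=.
  by rewrite !hornerE subrr mul0r.
have Lnz i : i \in E -> (L i).[a i] != 0.
  move=> iE; rewrite La; apply/prodf_neq0 => j; rewrite !inE => /andP[ji jE].
  by rewrite subr_eq0; apply: contraNneq ji => /inja ->.
pose r := p - \sum_(i in E) (p.[a i] / (L i).[a i]) *: L i.
have r0 : r = 0.
  apply: (@roots_geq_poly_eq0 _ r [seq a i | i <- enum E]).
  - apply/allP => v /mapP[i]; rewrite mem_enum => iE ->; rewrite rootE; apply/eqP.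
    rewrite !hornerE horner_sum (bigD1 i) //= big1 => [|j /andP[jE ji]].
      by rewrite addr0 hornerZ divfK ?subrr // Lnz.
    by rewrite hornerZ (La0 j i) ?mulr0 // eq_sym.
  - rewrite map_inj_in_uniq ?enum_uniq // => i j.
    by rewrite !mem_enum; apply: inja.
  - rewrite size_map -cardE; apply: leq_trans (size_polyD _ _) _.
    rewrite geq_max sp size_polyN; apply: leq_trans (size_sum _ _ _) _.
    apply/bigmax_leqP => i iE; apply: leq_trans (size_scale_leq _ _) _.
    by rewrite sL.
have /eqP := r0; rewrite subr_eq0 => /eqP pE; rewrite [in RHS]pE.
rewrite coef_sum; apply: eq_bigr => i iE.
rewrite coefZ La -(sL i iE) -[_`_ _]/(lead_coef _).
by rewrite lead_coef_prod_XsubC mulr1.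
Qed.

(** The monic polynomial whose roots are the values not taken by [a].  For a
    point of a planar arc, with [a] listing the slopes of its secants, the roots
    are the slopes of its tangents. *)
Definition copoly (a : T -> F) : {poly F} :=
  \prod_(t in ~: [set a i | i : T]) ('X - t%:P).

Lemma size_copoly a : injective a -> size (copoly a) = (#|F| - #|T|).+1.
Proof.
move=> inja; rewrite size_prod_XsubC_set cardsCs setCK card_imset //.
Qed.

Lemma copoly_monic a : copoly a \is monic.
Proof. exact: monic_prod_XsubC. Qed.

Lemma copoly_eq0 a v : (forall i, a i != v) -> (copoly a).[v] = 0.
Proof.
move=> av; rewrite horner_prod (bigD1 v) /=; last first.
  by rewrite inE; apply/imsetP => -[i _ vE]; have := av i; rewrite vE eqxx.
by rewrite !hornerE subrr mul0r.
Qed.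

Lemma copolyE a i : injective a ->
  (copoly a).[a i] = - (\prod_(j in [set: T] :\ i) (a i - a j))^-1.
Proof.
move=> inja; have := prod_subf_neq (a i).
rewrite (bigID (mem [set a j | j : T])) /=.
have -> : \prod_(t | (t != a i) && (t \in [set a j | j : T])) (a i - t)
   = \prod_(j in [set: T] :\ i) (a i - a j).
  rewrite -(big_imset (h := a) (fun t => a i - t) (in2W inja)) /=.
  apply: eq_bigl => t; apply/andP/imsetP => [[ta /imsetP[j _ tE]]|[j]].
    by exists j => //; rewrite !inE andbT; apply: contraNneq ta => <-; rewrite tE.
  rewrite !inE andbT => ji ->; split; last exact: imset_f.
  by apply: contraNneq ji => /inja ->.
have -> : \prod_(t | (t != a i) && (t \notin [set a j | j : T])) (a i - t)
   = (copoly a).[a i].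
  rewrite horner_prod; apply: eq_big => [t|t _]; last by rewrite !hornerE.
  rewrite inE andbC; case: imsetP => //= tE; apply/eqP => ta.
  by case: tE; exists i.
move=> H; set P := \prod_(j in _) _ in H *.
have P0 : P != 0 by apply/eqP => P0; move: H; rewrite P0 mul0r => /eqP; rewrite eq_sym oppr_eq0 oner_eq0.
by apply: (mulfI P0); rewrite H mulrN divff.
Qed.

End Interpolation.

(** * Planar arcs: tangents and three points at infinity *)

(** The points [(x i, y i)] form an arc with the points at infinity of the
    directions [x = const] and [x + y = const], and also with those of
    [y = const] and [x + y = const].  Write [s i j] for the slope of a secant
    and [f i] for the polynomial of the tangent slopes at [i], of degree
    [t = #|F| - #|T|].  The slope 0 is a tangent slope, so [f i] vanishes at 0.
    The divided difference of [f i ^ 2 / X] over the slopes from [i] to a set [E]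
    of [2 t + 1] points (the slope [-1] standing for [i] itself) vanishes.  After
    rescaling by products of abscissa differences, the terms with [j != i] are
    antisymmetric in [i] and [j], which is the lemma of tangents; the terms with
    [j = i] sum to minus the divided difference of the square of the tangent
    polynomial at the third point, which is 1. *)
Lemma no_planar_configuration (F : finFieldType) (T : finType) (x y : T -> F) :
  (2 : F) != 0 -> injective x -> injective y -> injective (fun i => x i + y i) ->
  (forall (i j l : T) (s c : F), i != j -> i != l -> j != l ->
     y i = s * x i + c -> y j = s * x j + c -> y l = s * x l + c -> False) ->
  (3 * #|T| <= 2 * #|F|)%N.
Proof.
move=> F2 injx injy injz nocol; rewrite leqNgt; apply/negP => big.
pose z i := x i + y i.
set t := (#|F| - #|T|)%N.
have TF : (#|T| <= #|F|)%N by rewrite -(card_codom injx) max_card.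
have [E _ cE] : exists2 E : {set T}, E \subset [set: T] & #|E| = (2 * t).+1.
  by apply: subset_of_card; rewrite cardsT /t; lia.
pose s i j := (y j - y i) / (x j - x i).
have dx i j : i != j -> x j - x i != 0.
  by move=> ij; rewrite subr_eq0; apply: contraNneq ij => /injx ->.
have dz i j : i != j -> z i - z j != 0.
  by move=> ij; rewrite subr_eq0; apply: contraNneq ij => /injz ->.
have sx i j : i != j -> s i j * (x j - x i) = y j - y i.
  by move=> ij; rewrite divfK ?dx.
have sC i j : s i j = s j i.
  by rewrite /s -(opprB (x i)) -(opprB (y i)) invrN mulrNN.
have s0 i j : i != j -> s i j != 0.
  move=> ij; rewrite mulf_neq0 ?invr_eq0 ?dx // subr_eq0.
  by apply: contraNneq ij => /injy ->.
have s1 i j : i != j -> s i j + 1 != 0.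
  move=> ij; apply: contraTneq isT => sE.
  have /eqP : z i - z j = - ((s i j + 1) * (x j - x i)).
    by rewrite mulrDl sx // /z; ring.
  by rewrite sE mul0r oppr0 (negbTE (dz i j ij)).
(* the equation of the secant [i j], evaluated at the point [k] *)
pose l i j k := s i j * (x k - x i) - (y k - y i).
have lC i j k : i != j -> l i j k = l j i k.
  move=> ij; rewrite /l -(sC i j).
  have H := sx i j ij; apply/eqP; rewrite -subr_eq0; apply/eqP.
  transitivity (s i j * (x j - x i) - (y j - y i)); first ring.
  by rewrite H subrr.
have l0 i j k : i != j -> i != k -> j != k -> l i j k != 0.
  move=> ij ik jk; apply/eqP => lE.
  apply: (nocol i j k (s i j) (y i - s i j * x i)) => //; first ring.
    by rewrite -[LHS](subrK (y i)) -(sx i j ij); ring.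
  by rewrite -[LHS](subrK (y i)) -(subr0_eq lE); ring.
(* the index [i] itself carries the slope of the direction [x + y = const] *)
pose a i j := if j == i then -1 else s i j.
have aii i : a i i = -1 by rewrite /a eqxx.
have aij i j : i != j -> a i j = s i j by rewrite /a eq_sym => /negbTE ->.
have inja i : injective (a i).
  move=> j k; apply: contra_eq => jk.
  have [ij|ij] := eqVneq i j.
    subst j; rewrite aii aij //; apply: contraNneq (s1 i k jk) => <-; apply/eqP; ring.
  have [ik|ik] := eqVneq i k.
    subst k; rewrite aii aij //; apply: contraNneq (s1 i j ij) => ->; apply/eqP; ring.
  rewrite !aij //; apply: contraNneq (l0 i j k ij ik jk) => sE.
  by rewrite /l sE sx // subrr.
have a0 i j : a i j != 0.
  by have [<-|ij] := eqVneq i j; rewrite ?aii ?oppr_eq0 ?oner_eq0 // aij ?s0.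
pose f i := copoly (a i).
(* [h i = (f i) ^ 2 / X] *)
have [h hE sh] : exists2 h : T -> {poly F},
    forall i j, (h i).[a i j] = (f i).[a i j] ^+ 2 / a i j &
    forall i, (size (h i) <= 2 * t)%N.
  have g i : {g : {poly F} | f i == g * 'X}.
    apply/sigW; have /factor_theorem[g gE] : root (f i) 0.
      by apply/eqP; apply: copoly_eq0.
    by exists g; rewrite gE subr0.
  exists (fun i => val (g i) * f i) => [i j|i]; case: (g i) => g' /= /eqP gE.
    by rewrite hornerM gE hornerMX; field; apply: a0.
  have := size_copoly (inja i); rewrite -/(f i) {1}gE -/t.
  have [->|g0] := eqVneq g' 0; first by rewrite mul0r size_poly0.
  rewrite size_mulX // => -[sg]; apply: leq_trans (size_polyMleq _ _) _.
  by rewrite sg size_copoly //; lia.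
pose c (G : {set T}) i := \prod_(k in G :\ i) (x k - x i).
have c0 G i : c G i != 0.
  by apply/prodf_neq0 => k; rewrite !inE eq_sym => /andP[ki _]; apply: dx.
pose Z (G : {set T}) i := \prod_(k in G :\ i) (z i - z k).
have Z0 G i : Z G i != 0.
  by apply/prodf_neq0 => k; rewrite !inE eq_sym => /andP[ki _]; apply: dz.
(* the rescaled product of slope differences, antisymmetric in [i] and [j] *)
pose K (G : {set T}) i j := (s i j + 1) * (x j - x i) * \prod_(k in G :\ i :\ j) l i j k.
have K0 G i j : i != j -> K G i j != 0.
  move=> ij; rewrite !mulf_neq0 ?s1 ?dx //; apply/prodf_neq0 => k.
  by rewrite !inE => /and3P[kj ki _]; rewrite l0 // eq_sym.
have KC G i j : i != j -> K G j i = - K G i j.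
  move=> ij; rewrite /K (sC j i).
  rewrite [X in _ * X](_ : _ = \prod_(k in G :\ i :\ j) l i j k); first ring.
  apply: eq_big => [k|k _]; last by rewrite -lC.
  by rewrite !inE; case: (k == i); case: (k == j).
have diag (G : {set T}) i : \prod_(k in G :\ i) (a i i - a i k) = Z G i / c G i.
  apply: (mulIf (c0 G i)); rewrite divfK // /c -big_split /=.
  apply: eq_bigr => k; rewrite !inE eq_sym => /andP[ik _].
  rewrite aii aij // mulrBl sx // /z; ring.
have offdiag (G : {set T}) i j : i \in G -> j \in G -> i != j ->
    \prod_(k in G :\ j) (a i j - a i k) = K G i j / c G i.
  move=> iG jG ij; apply: (mulIf (c0 G i)); rewrite divfK //.
  rewrite (bigD1 i) ?inE ?ij //= /c.
  rewrite [\prod_(k in G :\ i) _](bigD1 j) ?inE ?(eq_sym j) ?ij //=.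
  rewrite aii aij // opprK mulrACA /K; congr (_ * _).
  rewrite (eq_bigl (mem (G :\ i :\ j))); last first.
    by move=> k /=; rewrite !inE; case: (k == i); case: (k == j); rewrite ?andbF ?andbT.
  rewrite mulrC (eq_bigl (mem (G :\ i :\ j))); last first.
    by move=> k /=; rewrite !inE; case: (k == i); case: (k == j); rewrite ?andbF ?andbT.
  rewrite -big_split /=; apply: eq_bigr => k; rewrite !inE => /and3P[kj ki _].
  by rewrite [a i k]aij 1?eq_sym // mulrBr [_ * s i k]mulrC sx 1?eq_sym // /l mulrC.
pose w i j := (h i).[a i j] / \prod_(k in E :\ j) (a i j - a i k)
  / (c [set: T] i ^+ 2 * c E i).
have sumw i : i \in E -> \sum_(j in E) w i j = 0.
  move=> iE; rewrite -mulr_suml sum_divided_difference; last first.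
  - by rewrite cE; apply: leq_trans (sh i) _.
  - by move=> ? ? _ _; apply: inja.
  by rewrite cE /= nth_default ?mul0r.
have wii i : i \in E -> w i i = - ((copoly z).[z i] ^+ 2 / Z E i).
  move=> iE; rewrite /w hE diag /f !copolyE // diag -/(Z _ _) aii.
  by field; rewrite !Z0 !c0 oppr_eq0 oner_eq0.
have wij i j : i \in E -> j \in E -> i != j ->
    w i j = (K [set: T] i j ^+ 2 * s i j * K E i j)^-1.
  move=> iE jE ij; rewrite /w hE offdiag // /f copolyE // offdiag ?inE //.
  by rewrite aij //; field; rewrite s0 ?K0 ?c0.
(* the off-diagonal terms cancel in pairs *)
pose v i j := if i == j then 0 else w i j.
have vC i j : i \in E -> j \in E -> v j i = - v i j.
  move=> iE jE; rewrite /v eq_sym; case: eqVneq => [_|ij]; first by rewrite oppr0.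
  have ji : j != i by rewrite eq_sym.
  by rewrite (wij i j) // (wij j i) // !(KC _ i j) // (sC j i) sqrrN mulrN invrN.
have V0 : \sum_(i in E) \sum_(j in E) v i j = 0.
  have H : \sum_(i in E) \sum_(j in E) v i j = - \sum_(i in E) \sum_(j in E) v i j.
    rewrite {1}exchange_big /= -sumrN; apply: eq_bigr => i iE.
    by rewrite -sumrN; apply: eq_bigr => j jE; rewrite vC.
  apply/eqP; have /eqP : 2 * \sum_(i in E) \sum_(j in E) v i j = 0.
    by rewrite mulr_natl mulr2n {2}H subrr.
  by rewrite mulf_eq0 (negbTE F2).
have D0 : \sum_(i in E) w i i = 0.
  have : \sum_(i in E) \sum_(j in E) w i j = 0 by apply: big1.
  rewrite (eq_bigr (fun i => w i i + \sum_(j in E) v i j)); last first.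
    move=> i iE; rewrite (bigD1 i) //= [in RHS](bigD1 i) //= [v i i]/v eqxx add0r.
    by congr (_ + _); apply: eq_bigr => j /andP[_ ji]; rewrite /v eq_sym (negbTE ji).
  by rewrite big_split /= V0 addr0.
have szR : size (copoly z ^+ 2) = #|E|.
  rewrite expr2 size_Mmonic ?monic_neq0 ?copoly_monic //.
  by rewrite size_copoly // cE; lia.
have := sum_divided_difference (E := E) (a := z) (p := copoly z ^+ 2).
rewrite szR => /(_ (in2W injz) (leqnn _)).
rewrite -szR -[_`_ _]/(lead_coef _) (monicP (monic_exp _ (copoly_monic z))).
under eq_bigr => i iE do rewrite horner_exp -/(Z E i) -[_ / _]opprK -wii //.
by rewrite sumrN D0 oppr0 => /eqP; rewrite eq_sym oner_eq0.
Qed.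

(** * Arcs as generator matrices *)

Section Arcs.
Variable F : finFieldType.

(** The positions where the word [u *m B] vanishes. *)
Definition zeros k m (B : 'M[F]_(k, m)) (u : 'rV[F]_k) : {set 'I_m} :=
  [set j | (u *m B) 0 j == 0].

(** Any [k + 1] columns of [B] are linearly independent, stated dually. *)
Definition arc k m (B : 'M[F]_(k.+1, m)) : bool :=
  [forall u : 'rV_k.+1, (u != 0) ==> (#|zeros B u| <= k)%N].

(** The row space of [B]. *)
Definition code k m (B : 'M[F]_(k, m)) : {set 'rV[F]_m} :=
  [set u *m B | u : 'rV_k].

Section Coordinates.
Variables (k m : nat) (B : 'M[F]_(k, m)) (j : 'I_m).
Implicit Types u v : 'rV[F]_k.

Lemma coord0 : ((0 : 'rV[F]_k) *m B) 0 j = 0.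
Proof. by rewrite mul0mx mxE. Qed.

Lemma coordD u v : ((u + v) *m B) 0 j = (u *m B) 0 j + (v *m B) 0 j.
Proof. by rewrite mulmxDl mxE. Qed.

Lemma coordN u : ((- u) *m B) 0 j = - (u *m B) 0 j.
Proof. by rewrite mulNmx mxE. Qed.

Lemma coordZ c u : ((c *: u) *m B) 0 j = c * (u *m B) 0 j.
Proof. by rewrite -scalemxAl mxE. Qed.

Lemma coord_sum (I : finType) (w : I -> 'rV[F]_k) :
  ((\sum_i w i) *m B) 0 j = \sum_i (w i *m B) 0 j.
Proof. by rewrite mulmx_suml summxE. Qed.

Definition coordE := (coordD, coordN, coordZ, coord_sum).

End Coordinates.

Lemma arc_eq0 k m (B : 'M[F]_(k.+1, m)) (X : {set 'I_m}) (u : 'rV[F]_k.+1) :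
  arc B -> (k < #|X|)%N -> {in X, forall j, (u *m B) 0 j = 0} -> u = 0.
Proof.
move=> /forallP/(_ u) arcB kX uX; apply/eqP; apply: contraLR kX => u0.
rewrite -leqNgt; apply: leq_trans (implyP arcB u0).
by apply/subset_leq_card/subsetP => j jX; rewrite inE uX.
Qed.

Lemma arc_interpolation k m (B : 'M[F]_(k.+1, m)) (X : {set 'I_m}) (g : 'I_m -> F) :
  arc B -> #|X| = k.+1 -> exists u : 'rV[F]_k.+1, {in X, forall j, (u *m B) 0 j = g j}.
Proof.
move=> arcB cX.
(* evaluation at [X] is injective between spaces of the same cardinality *)
pose ev (u : 'rV[F]_k.+1) : 'rV[F]_#|X| := \row_e (u *m B) 0 (enum_val e).
have inj_ev : injective ev.
  move=> u v euv; apply/eqP; rewrite -subr_eq0; apply/eqP.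
  apply: (arc_eq0 (X := X) arcB); first by rewrite cX.
  move=> j jX; have /rowP/(_ (enum_rank_in jX j)) := euv.
  rewrite mxE [in RHS]mxE enum_rankK_in // => euvj.
  by rewrite !coordE euvj subrr.
have /codomP[u uE] : (\row_e g (enum_val e)) \in codom ev.
  by apply: inj_card_onto; rewrite // !card_mx cX.
exists u => j jX; have /rowP/(_ (enum_rank_in jX j)) := uE.
by rewrite mxE [in RHS]mxE enum_rankK_in.
Qed.

(** If [g] is affine with nonzero slope along every line parallel to a
    coordinate axis, then it is affine: the slope along one axis is an affine
    function of each coordinate, and an affine function on the field that is
    never zero is constant. *)
Lemma affine_of_axes k (g : 'rV[F]_k -> F) :
  (forall i x, exists2 s, s != 0 &
     forall t, g (x + t *: delta_mx 0 i) = g x + s * t) ->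
  exists b : 'cV[F]_k, forall x, g x = g 0 + (x *m b) 0 0.
Proof.
move=> Hg; pose s i x := g (x + delta_mx 0 i) - g x.
have gs i x t : g (x + t *: delta_mx 0 i) = g x + s i x * t.
  have [r _ Hr] := Hg i x; rewrite Hr /s; congr (_ + _ * _).
  by rewrite -[delta_mx 0 i]scale1r Hr; ring.
have s0 i x : s i x != 0.
  have [r r0 Hr] := Hg i x; rewrite /s -[delta_mx 0 i]scale1r Hr.
  by rewrite addrAC subrr add0r mulr1.
have s_const i j x t : s i (x + t *: delta_mx 0 j) = s i x.
  have E r : s i (x + r *: delta_mx 0 j)
      = s i x + (s j (x + delta_mx 0 i) - s j x) * r.
    by rewrite [s i (x + _)]/s addrAC !gs [s i x]/s; ring.
  have [d0|d0] := eqVneq (s j (x + delta_mx 0 i) - s j x) 0.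
    by rewrite E d0 mul0r addr0.
  have /eqP[] := s0 i (x + (- (s i x / (s j (x + delta_mx 0 i) - s j x))) *: delta_mx 0 j).
  by rewrite E mulrN mulrCA divff // mulr1 subrr.
have s_sum i (t : 'I_k -> F) r : s i (\sum_(j <- r) t j *: delta_mx 0 j) = s i 0.
  elim: r => [|j r IHr]; first by rewrite big_nil.
  by rewrite big_cons addrC s_const.
exists (\col_i s i 0) => x; rewrite {1}[x]row_sum_delta mxE.
elim: (index_enum _) => [|j r IHr]; first by rewrite !big_nil addr0.
by rewrite !big_cons addrC gs IHr s_sum mxE; ring.
Qed.

End Arcs.

(** * A new coordinate is a relabelled linear form *)

(** The hypothesis on [phi] says that the words [u *m A], with [phi u] as an
    additional coordinate, agree pairwise in at most [k] positions. *)
Lemma extension_coordinate_linear (q k n : nat) (A : 'M['F_q]_(k.+1, n))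
    (phi : 'rV['F_q]_k.+1 -> 'F_q) :
  prime q -> arc A -> (2 * q.-1 + 3 * k < 3 * n)%N ->
  (forall u v, u != v -> phi u = phi v ->
     (#|[set i | (u *m A) ord0 i == (v *m A) ord0 i]| < k)%N) ->
  exists (b : 'cV['F_q]_k.+1) (sigma : {perm 'F_q}),
    forall u, phi u = sigma ((u *m b) 0 0).
Proof.
move=> q_pr arcA n_big Hphi; have q1 := prime_gt1 q_pr.
have kn : (k < n)%N by lia.
pose h (i : 'I_k) : 'I_n := widen_ord (ltnW kn) i.
have injh : injective h by move=> i j /(congr1 val) /= /val_inj.
pose l0 : 'I_n := Ordinal kn.
pose X := [set h i | i : 'I_k].
have cX : #|X| = k by rewrite card_imset // card_ord.
have l0X : l0 \notin X.
  by apply/imsetP => -[i _ /(congr1 val) /= kE]; have := ltn_ord i; rewrite -kE ltnn.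
have cX1 : #|l0 |: X| = k.+1 by rewrite cardsU1 l0X cX.
have hX i : h i \in l0 |: X by rewrite !inE imset_f ?orbT.
have hl0 i : (h i == l0) = false.
  by apply: contraNF l0X => /eqP <-; apply: imset_f.
have [e0 e0E] := arc_interpolation (fun j => (j == l0)%:R) arcA cX1.
have [eps epsE] := fin_all_exists (fun i : 'I_k =>
  arc_interpolation (fun j => (j == h i)%:R) arcA cX1).
(* coordinates on the message space: [y] at position [l0], [x] on [X] *)
pose word y (x : 'rV_k) := y *: e0 + \sum_i x 0 i *: eps i.
have wordE y x l : (word y x *m A) 0 l
    = y * (e0 *m A) 0 l + \sum_i x 0 i * (eps i *m A) 0 l.
  rewrite !coordE; congr (_ + _); apply: eq_bigr => i _.
  by rewrite coordZ.
have word0 y x : (word y x *m A) 0 l0 = y.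
  rewrite wordE e0E ?setU11 // eqxx mulr1 big1 ?addr0 // => i _.
  by rewrite epsE ?setU11 // eq_sym hl0 mulr0.
have wordh y x i : (word y x *m A) 0 (h i) = x 0 i.
  rewrite wordE e0E // hl0 mulr0 add0r (bigD1 i) //= epsE // eqxx mulr1.
  rewrite big1 ?addr0 // => j ji.
  by rewrite epsE // (inj_eq injh) eq_sym (negbTE ji) mulr0.
have wordK u : u = word ((u *m A) 0 l0) (\row_i (u *m A) 0 (h i)).
  apply/eqP; rewrite -subr_eq0; apply/eqP.
  apply: (arc_eq0 (X := l0 |: X) arcA); first by rewrite cX1.
  move=> j; rewrite coordD coordN !inE => /orP[/eqP ->|/imsetP[i _ ->]].
    by rewrite word0 subrr.
  by rewrite wordh [in X in _ - X]mxE subrr.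
clearbody word.
have inj_phi x : injective (fun y => phi (word y x)).
  move=> y y' /= eyy'; apply/eqP; apply: contraT => yy'.
  have uv : word y x != word y' x.
    by apply: contraNneq yy' => uv; rewrite -(word0 y x) uv word0.
  have := Hphi _ _ uv eyy'; rewrite ltnNge => /negP; case.
  rewrite -{1}cX; apply/subset_leq_card/subsetP => _ /imsetP[i _ ->].
  by rewrite inE !wordh.
(* the level set [phi = a] is the graph [y = g a x] *)
pose g a x := invF (inj_phi x) a.
have phig a x : phi (word (g a x) x) = a by rewrite (f_invF (inj_phi x)).
have gphi y x : g (phi (word y x)) x = y by rewrite /g (invF_f (inj_phi x)).
clearbody g.
have e0nz l : l \notin X -> (e0 *m A) 0 l != 0.
  move=> lX; apply: contraTneq isT => e0l.
  have : e0 = 0.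
    apply: (arc_eq0 (X := l |: X) arcA); first by rewrite cardsU1 lX cX.
    move=> j; rewrite !inE => /orP[/eqP -> //|/imsetP[i _ ->]].
    by rewrite e0E // hl0.
  move/(congr1 (fun u => (u *m A) 0 l0)); rewrite e0E ?setU11 // eqxx coord0.
  by move/eqP; rewrite oner_eq0.
(* [g a] is affine along the axes, by the result on directions *)
have axes a i x : exists2 s, s != 0 &
    forall t, g a (x + t *: delta_mx 0 i) = g a x + s * t.
  pose f t := g a (x + t *: delta_mx 0 i).
  pose c l := (eps i *m A) 0 l / (e0 *m A) 0 l.
  pose S := [set c l | l in ~: X].
  have cXi : #|X :\ h i| = k.-1 by rewrite -cX (cardsD1 (h i) X) imset_f.
  have k0 : (0 < k)%N := leq_ltn_trans (leq0n i) (ltn_ord i).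
  have cS : #|S| = (n - k)%N.
    rewrite card_in_imset; first by rewrite cardsCs setCK cX card_ord.
    move=> l l'; rewrite !inE => lX l'X; apply: contra_eq => ll'.
    apply/eqP => cll'.
    have : eps i - c l *: e0 = 0.
      apply: (arc_eq0 (X := l |: (l' |: (X :\ h i))) arcA).
        by rewrite !cardsU1 !inE (negbTE ll') (negbTE lX) (negbTE l'X) !andbF cXi; lia.
      move=> j; rewrite !coordE !inE => /or3P[/eqP->|/eqP->|].
      - by rewrite divfK ?subrr ?e0nz.
      - by rewrite cll' divfK ?subrr ?e0nz.
      case/andP=> ji /imsetP[i' _ jE]; rewrite jE in ji *.
      by rewrite epsE // (negbTE ji) e0E // hl0 mulr0 subrr.
    move/(congr1 (fun u => (u *m A) 0 (h i))).
    rewrite !coordE coord0 epsE // eqxx e0E // hl0 mulr0 subr0.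
    by move/eqP; rewrite oner_eq0.
  have injS : {in S, forall c', injective (fun t => f t + c' * t)}.
    move=> _ /imsetP[l lX ->] t t'; rewrite inE in lX.
    move=> eft; apply/eqP; apply: contraT => tt'.
    have uv : word (f t) (x + t *: delta_mx 0 i) != word (f t') (x + t' *: delta_mx 0 i).
      apply: contraNneq tt' => /(congr1 (fun u => (u *m A) 0 (h i))).
      by rewrite !wordh !mxE !eqxx !mulr1 => /addrI ->.
    have := Hphi _ _ uv; rewrite !phig ltnNge => /(_ erefl)/negP; case.
    have ck : #|l |: (X :\ h i)| = k by rewrite cardsU1 !inE (negbTE lX) andbF cXi; lia.
    apply: (leq_trans (eq_leq (esym ck))).
    apply/subset_leq_card/subsetP => j; rewrite !inE => /orP[/eqP->|/andP[ji]].
      have E r : (word (f r) (x + r *: delta_mx 0 i) *m A) 0 l =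
          (e0 *m A) 0 l * (f r + c l * r) + \sum_i x 0 i * (eps i *m A) 0 l.
        rewrite wordE mulrDr /c mulrA [_ * (_ / _)]mulrC divfK ?e0nz //.
        rewrite mulrC -addrA; congr (_ + _).
        rewrite (bigD1 i) //= [in RHS](bigD1 i) //= !mxE !eqxx mulr1.
        rewrite mulrDl addrA [_ * r]mulrC [_ * _ + r * _]addrC -!addrA; congr (_ + (_ + _)).
        by apply: eq_bigr => i' /negbTE ii'; rewrite !mxE ii' andbF mulr0 addr0.
      by rewrite !E eft.
    case/imsetP => i' _ jE; rewrite jE in ji *; rewrite !wordh !mxE.
    by move: ji; rewrite (inj_eq injh) => /negbTE ->; rewrite andbF !mulr0.
  have [|s fs] := affine_of_few_directions q_pr _ injS; first by rewrite cS; lia.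
  exists s; last by move=> t; rewrite -/(f t) fs /f scale0r addr0.
  have S0 : 0 \in S.
    apply/imsetP; exists l0; rewrite ?inE // /c epsE ?setU11 //.
    by rewrite eq_sym hl0 mul0r.
  apply: contra_neq (oner_neq0 'F_q) => sE; apply: (injS 0 S0) => /=.
  by rewrite !mul0r !addr0 fs sE mul0r addr0.
have [b bE] := fin_all_exists (fun a => affine_of_axes (axes a)).
(* the slopes agree on all level sets, since these are disjoint *)
have bC a : b a = b 0.
  apply/colP => i; apply/eqP; apply: contraT => bne.
  have d0 : b a i 0 - b 0 i 0 != 0 by rewrite subr_eq0.
  pose t := - ((g a 0 - g 0 0) / (b a i 0 - b 0 i 0)).
  have scal a' : ((t *: delta_mx 0 i : 'rV_k) *m b a') 0 0 = t * b a' i 0.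
    by rewrite -scalemxAl mxE -rowE mxE.
  have gE : g a (t *: delta_mx 0 i) = g 0 (t *: delta_mx 0 i).
    rewrite bE [RHS]bE !scal; apply/eqP; rewrite -subr_eq0; apply/eqP.
    transitivity (g a 0 - g 0 0 + t * (b a i 0 - b 0 i 0)); first ring.
    by rewrite /t mulNr divfK // subrr.
  have := phig a (t *: delta_mx 0 i); rewrite gE phig => a0.
  by rewrite -a0 eqxx in bne.
have inj_tau : injective (fun a => g a 0).
  by move=> a a' /= gE; rewrite -(phig a 0) gE phig.
exists (col l0 A - \sum_i b 0 i 0 *: col (h i) A), (perm inj_tau)^-1%g => u.
apply: (@perm_inj _ (perm inj_tau)); rewrite permKV permE.
set a := phi u; have aE : a = phi (word ((u *m A) 0 l0) (\row_i (u *m A) 0 (h i))).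
  by rewrite -wordK.
have := gphi ((u *m A) 0 l0) (\row_i (u *m A) 0 (h i)); rewrite -aE bE bC.
move=> yE; apply: (addIr ((\row_i (u *m A) 0 (h i) *m b 0) 0 0)); rewrite yE.
have colE j : (u *m col j A) 0 0 = (u *m A) 0 j.
  by rewrite !mxE; apply: eq_bigr => e _; rewrite !mxE.
have -> : (u *m (col l0 A - \sum_i b 0 i 0 *: col (h i) A)) 0 0
    = (u *m A) 0 l0 - \sum_i b 0 i 0 * (u *m A) 0 (h i).
  rewrite mulmxBr mulmx_sumr mxE colE [in X in _ + X]mxE summxE; congr (_ - _).
  by apply: eq_bigr => i _; rewrite -scalemxAr mxE colE.
rewrite [(\row_i _ *m _) _ _]mxE; under [X in _ = _ + X]eq_bigr => i _ do rewrite [in X in X * _]mxE mulrC.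
by rewrite subrK.
Qed.

(** * Adding two columns to a large arc *)

Section TwoPoint.
Variable F : finFieldType.

(** If the columns of [B] indexed by [I] form an arc, they still form an arc
    when the column [a] is added. *)
Definition ext_on k m (B : 'M[F]_(k.+1, m)) (I : {set 'I_m}) (a : 'cV[F]_k.+1) : Prop :=
  forall u : 'rV_k.+1, u != 0 -> (u *m a) 0 0 = 0 -> (#|I :&: zeros B u| < k)%N.

(** Otherwise some [v0] annihilates [a], the column [j] and [k - 1] columns of
    [I], indexed by [Z].  In terms of the words dual to the columns of
    [Z], of [j] and of one further index [i0], the form [a] has a nonzero
    coefficient at some [r] in [Z].  On the space spanned by the words dual to
    [i0], [r] and [j], where the columns of [Z] other than [r] vanish, the forms
    [j], [a] and [r] are collinear, and the forms indexed by [I :\: Z] become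
    the affine points of a planar configuration. *)
Lemma ext_on_setU1 k m (B : 'M[F]_(k.+1, m)) (I : {set 'I_m}) (j : 'I_m) a :
  (2 : F) != 0 -> arc B -> j \notin I -> (2 * #|F| + 3 * k < 3 * #|I| + 3)%N ->
  ext_on B I a -> (forall c, a != c *: col j B) -> ext_on B (j |: I) a.
Proof.
move=> F2 arcB jI bigI extI nprop v0 v0nz v0a; rewrite ltnNge; apply/negP => kle.
have := extI v0 v0nz v0a; set Z := I :&: zeros B v0 => ltZ.
have ZI : Z \subset I by apply: subsetIl.
have jZ : j \notin Z by apply: contra jI; apply: (subsetP ZI).
have v0j : (v0 *m B) 0 j = 0.
  apply/eqP; apply: contraT => v0j; have : (k <= #|Z|)%N; last by rewrite leqNgt ltZ.
  apply: leq_trans kle _; apply/subset_leq_card/subsetP => i; rewrite !inE.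
  by case/andP=> /orP[/eqP->|->]; rewrite ?(negbTE v0j).
have cZ1 : #|j |: Z| = k.
  apply/eqP; rewrite eqn_leq {1}cardsU1 jZ add1n ltZ /=; apply: leq_trans kle _.
  apply/subset_leq_card/subsetP => i; rewrite !inE.
  by case/andP=> /orP[/eqP->|->] ->; rewrite ?eqxx ?orbT.
have k0 : (0 < k)%N by apply: leq_ltn_trans ltZ.
have cZ : #|Z| = k.-1 by rewrite -cZ1 cardsU1 jZ.
have [i0 i0I i0Z] : exists2 i, i \in I & i \notin Z.
  apply/subsetPn; apply/negP => /subset_leq_card; rewrite cZ; move: bigI k0; clear; lia.
have i0j : i0 != j by apply: contraNneq jI => <-.
set X := i0 |: (j |: Z).
have cX : #|X| = k.+1 by rewrite cardsU1 in_setU1 (negbTE i0j) (negbTE i0Z) cZ1.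
have i0X : i0 \in X by rewrite !inE eqxx.
have jX : j \in X by rewrite !inE eqxx orbT.
have ZX r : r \in Z -> r \in X by move=> rZ; rewrite !in_setU rZ !orbT.
(* for [c] in [X], [eps c] is the dual word: 1 at [c], 0 elsewhere on [X] *)
have [eps epsE] := fin_all_exists (fun c : 'I_m =>
  arc_interpolation (fun i => (i == c)%:R) arcB cX).
have expand u : u = \sum_(c in X) (u *m B) 0 c *: eps c.
  apply/eqP; rewrite -subr_eq0; apply/eqP.
  apply: (arc_eq0 (X := X) arcB); first by rewrite cX.
  move=> i iX; rewrite coordD coordN mulmx_suml summxE (bigD1 i) //=.
  rewrite coordZ epsE // eqxx mulr1 big1 ?addr0 ?subrr // => c /andP[cXX ci].
  by rewrite coordZ epsE // eq_sym (negbTE ci) mulr0.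
pose av c := (eps c *m a) 0 0.
have valE (u : 'rV[F]_k.+1) : (u *m a) 0 0 = \sum_(c in X) (u *m B) 0 c * av c.
  rewrite {1}(expand u) mulmx_suml summxE; apply: eq_bigr => c _.
  by rewrite -scalemxAl mxE.
have v0i0 : (v0 *m B) 0 i0 != 0.
  by move: i0Z; rewrite !inE i0I.
have v0Z r : r \in Z -> (v0 *m B) 0 r = 0 by rewrite !inE => /andP[_ /eqP].
have av0 : av i0 = 0.
  have := valE v0; rewrite v0a (bigD1 i0) //= big1 ?addr0.
    by move/esym/eqP; rewrite mulf_eq0 (negbTE v0i0) => /eqP.
  move=> c; rewrite !inE => /andP[/or3P[->//|/eqP-> _|]]; first by rewrite v0j mul0r.
  by case/andP=> _ /eqP->; rewrite mul0r.
(* otherwise [a] would be proportional to the column [j] *)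
have [r rZ avr] : exists2 r, r \in Z & av r != 0.
  apply/exists_inP; apply: contraT => /exists_inPn H.
  case/negP: (nprop (av j)); apply/eqP/colP => e.
  have := valE (delta_mx 0 e); rewrite -rowE mxE => ->.
  rewrite (bigD1 j) //= big1 ?addr0; first by rewrite -rowE !mxE mulrC.
  move=> c /andP[]; rewrite !in_setU !in_set1 => /or3P[/eqP->|->//|cZZ] _.
    by rewrite av0 mulr0.
  by have := H c cZZ; rewrite negbK => /eqP->; rewrite mulr0.
have avj : av j != 0.
  apply: contraT; rewrite negbK => /eqP avj.
  have ej0 : eps j != 0.
    apply: contraTneq isT => ej; have := epsE j j jX.
    by rewrite ej coord0 eqxx => /eqP; rewrite eq_sym oner_eq0.
  have := extI _ ej0 avj; rewrite ltnNge => /negP; case.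
  have c1 : #|i0 |: Z| = k by rewrite cardsU1 i0Z cZ add1n prednK.
  rewrite -{1}c1; apply/subset_leq_card/subsetP => i; rewrite in_setU1 => iE.
  rewrite in_setI; have [ij|ij] := eqVneq i j.
    by case/orP: iE => [/eqP i_i0|iZ]; [case/eqP: i0j; rewrite -i_i0 | case/negP: jZ; rewrite -ij].
  have iX : i \in X by case/orP: iE => [/eqP->|/ZX].
  rewrite [_ \in zeros _ _]inE epsE // (negbTE ij) eqxx andbT.
  by case/orP: iE => [/eqP->//|]; apply: (subsetP ZI).
have rj : r != j by apply: contraNneq jZ => <-.
have ri0 : r != i0 by apply: contraNneq i0Z => <-.
have rX := ZX r rZ.
pose lam := av r / av j.
have lam0 : lam != 0 by rewrite mulf_neq0 ?invr_eq0.
(* the three words that span the plane; the last one is annihilated by [a] *)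
pose comb p s t := p *: eps i0 + s *: eps r + t *: (lam *: eps j - eps r).
have combr p s t : (comb p s t *m B) 0 r = s - t.
  by rewrite /comb !coordE !epsE // eqxx (negbTE rj) (negbTE ri0) /=; ring.
have combj p s t : (comb p s t *m B) 0 j = t * lam.
  by rewrite /comb !coordE !epsE // eqxx (eq_sym j r) (negbTE rj) (eq_sym j i0) (negbTE i0j) /=; ring.
have combZ p s t i : i \in Z -> i != r -> (comb p s t *m B) 0 i = 0.
  move=> iZ ir; have iX := ZX i iZ; rewrite /comb !coordE !epsE // (negbTE ir).
  have -> : (i == i0) = false by apply: contraNF i0Z => /eqP<-.
  have -> : (i == j) = false by apply: contraNF jZ => /eqP<-.
  by rewrite !mulr0 subrr mulr0 !addr0.
have comba p s t : (comb p s t *m a) 0 0 = s * av r.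
  rewrite /comb !coordE -/(av i0) -/(av r) -/(av j) av0 /lam divfK // subrr; ring.
have u0 i : i \in I :\: Z -> (eps i0 *m B) 0 i != 0.
  rewrite inE => /andP[iZ iI]; apply: contraT; rewrite negbK => /eqP ui.
  have ij : i != j by apply: contraNneq jI => <-.
  have /eqP : eps i0 = 0.
    apply: (arc_eq0 (X := i |: (j |: Z)) arcB).
      by rewrite cardsU1 in_setU1 (negbTE ij) (negbTE iZ) cZ1.
    move=> e; rewrite in_setU1 => /orP[/eqP->//|eX].
    rewrite epsE; last by rewrite in_setU1 eX orbT.
    have -> : (e == i0) = false; last by [].
    apply/negbTE; apply: contraTneq eX => ->.
    by rewrite in_setU1 (negbTE i0j) (negbTE i0Z).
  move/eqP => e0; have := epsE i0 i0 i0X.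
  by rewrite e0 coord0 eqxx => /eqP; rewrite eq_sym oner_eq0.
pose T := {i : 'I_m | i \in I :\: Z}.
(* the affine coordinates of the form [i], relative to its value at [eps i0] *)
pose x (i : T) := (eps r *m B) 0 (val i) / (eps i0 *m B) 0 (val i).
pose y (i : T) := ((lam *: eps j - eps r) *m B) 0 (val i) / (eps i0 *m B) 0 (val i).
have combT p s t (i : T) :
    (comb p s t *m B) 0 (val i) = (eps i0 *m B) 0 (val i) * (p + s * x i + t * y i).
  rewrite /comb !coordE /x /y !coordE; field; exact: u0 (valP i).
have iT (i : T) : val i \in I /\ val i \notin Z.
  by have := valP i; rewrite inE => /andP[].
have valT (i i' : T) : i != i' -> val i != val i' by rewrite val_eqE.
have cZr : #|Z :\ r| = k.-2 by rewrite -cZ (cardsD1 r Z) rZ.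
have k1 : (1 < k)%N by rewrite -ltnS -(prednK k0) -cZ (cardsD1 r Z) rZ.
have notZr (i : T) : val i \notin Z :\ r.
  by rewrite inE negb_and (iT i).2 orbT.
have Tj (i : T) : (val i == j) = false by apply: contraNF jI => /eqP<-; exact: (iT i).1.
have cT : #|{: T}| = (#|I| - k.-1)%N.
  by rewrite card_sig -cZ -(cardsDS ZI); apply: eq_card => i; rewrite inE.
suff : (3 * #|{: T}| <= 2 * #|F|)%N by rewrite cT; move: bigI k0; clear; lia.
apply: (no_planar_configuration (x := x) (y := y) F2).
- move=> i i' xx; apply/eqP; apply: contraT => /valT ii'.
  have c0 : comb (- x i) 1 0 = 0.
    apply: (arc_eq0 (X := val i |: (val i' |: (j |: (Z :\ r)))) arcB).
      rewrite !cardsU1 !in_setU1 (negbTE ii') !Tj !(negbTE (notZr _)).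
      by rewrite inE (negbTE jZ) andbF cZr; move: k1; clear; lia.
    move=> e; rewrite !in_setU1 in_setD1 => /or4P[/eqP->|/eqP->|/eqP->|/andP[er eZ]].
    - by rewrite combT; ring.
    - by rewrite combT xx; ring.
    - by rewrite combj mul0r.
    - by rewrite combZ.
  by have /eqP := combr (- x i) 1 0; rewrite c0 coord0 subr0 eq_sym oner_eq0.
- move=> i i' yy; apply/eqP; apply: contraT => /valT ii'.
  have cnz : comb (- y i) 0 1 != 0.
    apply: contraTneq isT => c0; have /eqP := combr (- y i) 0 1.
    by rewrite c0 coord0 sub0r eq_sym oppr_eq0 oner_eq0.
  have := extI _ cnz; rewrite comba mul0r ltnNge => /(_ erefl)/negP; case.
  have cc : #|val i |: (val i' |: (Z :\ r))| = k.
    by rewrite !cardsU1 !in_setU1 (negbTE ii') !(negbTE (notZr _)) cZr; move: k1; clear; lia.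
  rewrite -{1}cc; apply/subset_leq_card/subsetP => e.
  rewrite !in_setU1 in_setI in_setD1 [_ \in zeros _ _]inE => /or3P[/eqP->|/eqP->|/andP[er eZ]].
  - by rewrite (iT i).1 combT /=; apply/eqP; ring.
  - by rewrite (iT i').1 combT yy /=; apply/eqP; ring.
  - by rewrite combZ // eqxx (subsetP ZI).
- move=> i i' /= zz; apply/eqP; apply: contraT => /valT ii'.
  have c0 : comb (- (x i + y i)) 1 1 = 0.
    apply: (arc_eq0 (X := val i |: (val i' |: Z)) arcB).
      by rewrite !cardsU1 !in_setU1 (negbTE ii') !(negbTE (iT _).2) cZ; move: k0; clear; lia.
    move=> e; rewrite !in_setU1 => /or3P[/eqP->|/eqP->|eZ].
    - by rewrite combT; ring.
    - by rewrite combT zz; ring.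
    - by have [->|er] := eqVneq e r; rewrite ?combr ?subrr ?combZ.
  by have /eqP := combj (- (x i + y i)) 1 1; rewrite c0 coord0 mul1r eq_sym (negbTE lam0).
- move=> i i' i'' s c /valT ii' /valT ii'' /valT i'i'' yi yi' yi''.
  have c0 : comb (- c) (- s) 1 = 0.
    apply: (arc_eq0 (X := val i |: (val i' |: (val i'' |: (Z :\ r)))) arcB).
      rewrite !cardsU1 !in_setU1 (negbTE ii') (negbTE ii'') (negbTE i'i'').
      by rewrite !(negbTE (notZr _)) cZr; move: k1; clear; lia.
    move=> e; rewrite !in_setU1 in_setD1 => /or4P[/eqP->|/eqP->|/eqP->|/andP[er eZ]].
    - by rewrite combT yi; ring.
    - by rewrite combT yi'; ring.
    - by rewrite combT yi''; ring.
    - by rewrite combZ.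
  by have /eqP := combj (- c) (- s) 1; rewrite c0 coord0 mul1r eq_sym (negbTE lam0).
Qed.

End TwoPoint.

(** * Relabelled codes of arcs *)

Section Codes.
Variable F : finFieldType.

(** A permutation of the alphabet in each column. *)
Definition relabel_all m (sigma : 'I_m -> {perm F}) (w : 'rV[F]_m) : 'rV[F]_m :=
  \row_j sigma j (w 0 j).

(** The row space of [B] with each column relabelled. *)
Definition rcode k m (sigma : 'I_m -> {perm F}) (B : 'M[F]_(k, m)) : {set 'rV[F]_m} :=
  [set relabel_all sigma (u *m B) | u : 'rV_k].

Lemma rcode1 k m (B : 'M[F]_(k, m)) : rcode (fun=> 1%g) B = code B.
Proof.
by apply: eq_imset => u; apply/rowP => j; rewrite mxE perm1.
Qed.

Lemma zeros_sub k m (B : 'M[F]_(k, m)) u v :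
  zeros B (u - v) = [set j | (u *m B) 0 j == (v *m B) 0 j].
Proof. by apply/setP => j; rewrite !inE coordD coordN subr_eq0. Qed.

Lemma arc_zeros k m (B : 'M[F]_(k.+1, m)) (u : 'rV_k.+1) :
  arc B -> u != 0 -> (#|zeros B u| <= k)%N.
Proof. by move=> /forallP/(_ u)/implyP. Qed.

Lemma arc_rcode_inj k m (sigma : 'I_m -> {perm F}) (B : 'M[F]_(k.+1, m)) :
  arc B -> (k < m)%N -> injective (fun u : 'rV_k.+1 => relabel_all sigma (u *m B)).
Proof.
move=> arcB km u v uv; apply/eqP; rewrite -subr_eq0; apply/eqP.
apply: (arc_eq0 (X := [set: 'I_m]) arcB); first by rewrite cardsT card_ord.
move=> j _; rewrite coordD coordN; have /rowP/(_ j) := uv.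
by rewrite mxE [in RHS]mxE => /perm_inj ->; rewrite subrr.
Qed.

Lemma arc_rcode_mds k m (sigma : 'I_m -> {perm F}) (B : 'M[F]_(k.+1, m)) :
  arc B -> (k < m)%N -> is_mds k.+1 (rcode sigma B).
Proof.
move=> arcB km; split.
  by rewrite card_imset ?card_mx ?mul1n //; apply: arc_rcode_inj.
move=> _ _ /imsetP[u _ ->] /imsetP[v _ ->] uv; rewrite ltnS.
have uv0 : u - v != 0 by rewrite subr_eq0; apply: contraNneq uv => ->.
apply: leq_trans (arc_zeros arcB uv0); rewrite zeros_sub.
apply/subset_leq_card/subsetP => j; rewrite !inE mxE [X in _ == X]mxE.
by rewrite (inj_eq perm_inj).
Qed.

Lemma arc_of_mds k m (B : 'M[F]_(k.+1, m)) : is_mds k.+1 (code B) -> arc B.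
Proof.
move=> [cB agreeB].
have injB : injective (fun u : 'rV_k.+1 => u *m B).
  have inj : {in 'rV[F]_k.+1 &, injective (fun u : 'rV_k.+1 => u *m B)}.
    by apply/imset_injP; rewrite -/(code B) cB card_mx mul1n.
  by move=> u v; apply: inj.
apply/forallP => u; apply/implyP => u0; rewrite -ltnS.
have uB : u *m B != 0 *m B by rewrite (inj_eq injB).
have := agreeB _ _ (imset_f _ _) (imset_f _ _) uB; rewrite -zeros_sub subr0.
by apply.
Qed.

Lemma arc_code_linear k m (B : 'M[F]_(k.+1, m)) :
  arc B -> (k < m)%N -> is_linear k.+1 (code B).
Proof.
move=> arcB km; pose f := linfun (mulmxr B : 'rV[F]_k.+1 -> 'rV[F]_m).
exists (limg f); split.
  rewrite limg_dim_eq; first by rewrite dimvf dim_matrix; apply: mul1n.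
  apply/eqP; rewrite -subv0; apply/subvP => u /memv_capP[_].
  rewrite memv_ker lfunE /= => /eqP uB; rewrite memv0; apply/eqP.
  apply: (arc_eq0 (X := [set: 'I_m]) arcB); first by rewrite cardsT card_ord.
  by move=> j _; rewrite uB mxE.
apply/setP => w; rewrite inE; apply/imsetP/memv_imgP => [[u _ ->]|[u _ ->]].
  by exists u; rewrite ?memvf // lfunE.
by exists u; rewrite // lfunE.
Qed.

Lemma linear_code_matrix k n (C : {set 'rV[F]_n}) :
  is_linear k C -> exists A : 'M[F]_(k, n), C = code A.
Proof.
move=> [V [dV ->]]; rewrite -dV.
exists (\matrix_(i < \dim V) (vbasis V)`_i).
apply/setP => w; rewrite inE; apply/idP/imsetP => [wV|[u _ ->]].
  exists (\row_i coord (vbasis V) i w) => //.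
  rewrite {1}(coord_vbasis wV) mulmx_sum_row; apply: eq_bigr => i _.
  by rewrite mxE rowK.
rewrite mulmx_sum_row; apply: memv_suml => i _; rewrite rowK; apply: memvZ.
by apply: vbasis_mem; apply: mem_nth; rewrite size_tuple.
Qed.

Lemma equivalent_relabel_all n m (C : {set 'rV[F]_n}) (D : {set 'rV[F]_m}) sigma :
  equivalent C D -> equivalent C [set relabel_all sigma w | w in D].
Proof.
move=> CD; pose rel_on (r : seq 'I_m) (w : 'rV[F]_m) : 'rV[F]_m :=
  \row_j if j \in r then sigma j (w 0 j) else w 0 j.
have H r : uniq r -> equivalent C [set rel_on r w | w in D].
  elim: r => [|j r IHr] /=.
    rewrite [X in equivalent C X](_ : _ = D) // -[RHS]imset_id; apply: eq_imset => w.
    by apply/rowP => i; rewrite mxE.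
  case/andP=> jr /IHr /(equivalent_relabel j (sigma j)); rewrite -imset_comp.
  congr (equivalent _ _); apply: eq_imset => w; apply/rowP => i; rewrite !mxE inE.
  by case: eqVneq => //= ->; rewrite (negbTE jr).
have := H _ (enum_uniq 'I_m); congr (equivalent _ _).
by apply: eq_imset => w; apply/rowP => j; rewrite !mxE mem_enum.
Qed.

(** Distinct columns of an arc are separated by a word. *)
Lemma arc_separate k m (B : 'M[F]_(k.+1, m)) (j j' : 'I_m) :
  arc B -> (0 < k)%N -> (k < m)%N -> j != j' ->
  exists u : 'rV_k.+1, (u *m B) 0 j = 1 /\ (u *m B) 0 j' = 0.
Proof.
move=> arcB k0 km jj'.
have [Y YX cY] : exists2 Y : {set 'I_m}, Y \subset ~: [set j; j'] & #|Y| = k.-1.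
  apply: subset_of_card; rewrite cardsCs setCK cards2 jj' card_ord; lia.
have nY i : i \in [set j; j'] -> i \notin Y.
  by move=> iX; apply: contraL iX => /(subsetP YX); rewrite inE.
have cX : #|j |: (j' |: Y)| = k.+1.
  by rewrite !cardsU1 in_setU1 (negbTE jj') !(negbTE (nY _ _)) ?set21 ?set22 // cY; lia.
have [u uE] := arc_interpolation (fun i => (i == j)%:R) arcB cX.
exists u; rewrite !uE ?inE ?eqxx ?orbT //; split=> //.
by rewrite eq_sym (negbTE jj').
Qed.

Lemma arc_cols_not_prop k m (B : 'M[F]_(k.+1, m)) (j j' : 'I_m) c :
  arc B -> (0 < k)%N -> (k < m)%N -> j != j' -> col j B != c *: col j' B.
Proof.
move=> arcB k0 km jj'; have [u [uj uj']] := arc_separate arcB k0 km jj'.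
apply: contra_neq (oner_neq0 F) => cE.
have colE i : (u *m B) 0 i = (u *m col i B) 0 0.
  by rewrite !mxE; apply: eq_bigr => e _; rewrite !mxE.
by rewrite -uj colE cE -scalemxAr mxE -colE uj' mulr0.
Qed.

Lemma ext_on_setT k m (B : 'M[F]_(k.+1, m)) (I : {set 'I_m}) a :
  (2 : F) != 0 -> arc B -> (2 * #|F| + 3 * k < 3 * #|I| + 3)%N ->
  ext_on B I a -> (forall j c, a != c *: col j B) -> ext_on B setT a.
Proof.
move=> F2 arcB + + nprop; move En: #|~: I| => N.
elim: N I En => [|N IHN] I cI bigI extI.
  by move/cards0_eq: cI => cI; rewrite -[setT]setC0 -cI setCK.
have [j jI] : exists j, j \in ~: I by apply/set0Pn; rewrite -card_gt0 cI.
rewrite inE in jI.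
apply: (IHN (j |: I)).
- by rewrite setCU setIC -setDE; move: cI; rewrite (cardsD1 j) inE jI => -[].
- by rewrite cardsU1 jI; lia.
- exact: ext_on_setU1.
Qed.

Lemma arc_row_mx k m (B : 'M[F]_(k.+1, m)) a :
  arc B -> ext_on B setT a -> arc (row_mx B a).
Proof.
move=> arcB extB; apply/forallP => u; apply/implyP => u0.
rewrite -sum1_card big_mkcond big_split_ord /= big_ord1.
have -> : (\sum_(i < m) (if lshift 1 i \in zeros (row_mx B a) u then 1 else 0))%N
    = #|zeros B u|.
  rewrite -sum1_card [RHS]big_mkcond; apply: eq_bigr => i _.
  by rewrite !inE mul_mx_row row_mxEl.
rewrite inE mul_mx_row row_mxEr; case: eqP => [ua|_]; last by rewrite addn0 arc_zeros.
by rewrite addn1; have := extB u u0 ua; rewrite setTI.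
Qed.

Lemma extension_rcode k n m (A : 'M[F]_(k.+1, n)) (B : 'M[F]_(k.+1, m))
    (f : 'I_n -> 'I_m) sigma tau :
  arc A -> arc B -> (k < n)%N -> (n < m)%N -> {homo f : i j / (i < j)%N} ->
  colsub f B = A -> (forall i, tau (f i) = sigma i) ->
  is_extension k.+1 (rcode sigma A) (rcode tau B).
Proof.
move=> arcA arcB kn nm f_mono fB fsigma.
split=> //; [exact: arc_rcode_mds | apply: arc_rcode_mds => //; lia |].
exists f; split=> //; rewrite /rcode -imset_comp; apply: eq_imset => u.
apply/rowP => i; rewrite /= !mxE fsigma -fB; congr (sigma i _).
by apply: eq_bigr => e _; rewrite !mxE.
Qed.

End Codes.

(** * Extensions of the code of an arc *)

Lemma homo_ord_inj n m (f : 'I_n -> 'I_m) :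
  {homo f : i j / (i < j)%N} -> injective f.
Proof.
move=> f_mono i j fij; apply: val_inj => /=.
by case: (ltngtP i j) => // /f_mono; rewrite fij ltnn.
Qed.

(** Every extension of the code of a large arc is the code of a larger arc, up
    to relabelling.  The words of [D] are indexed by [u] through the word
    [u *m A] that they extend. *)
Lemma extension_is_rcode (q k n m : nat) (A : 'M['F_q]_(k.+1, n)) (D : {set 'rV['F_q]_m}) :
  prime q -> arc A -> (2 * q.-1 + 3 * k < 3 * n)%N ->
  is_extension k.+1 (code A) D ->
  exists (B : 'M['F_q]_(k.+1, m)) (sigma : 'I_m -> {perm 'F_q}) (f : 'I_n -> 'I_m),
    [/\ arc B, {homo f : i j / (i < j)%N}, colsub f B = A & D = rcode sigma B].
Proof.
move=> q_pr arcA n_big [nm Amds [cD agreeD] [f [f_mono AE]]].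
have injf := homo_ord_inj f_mono.
have kn : (k < n)%N by lia.
have [g gP] : exists g : 'rV['F_q]_k.+1 -> 'rV['F_q]_m,
    forall u, g u \in D /\ colsub f (g u) = u *m A.
  apply: (fin_all_exists (P := fun u w => w \in D /\ colsub f w = u *m A)) => u.
  have : u *m A \in code A by apply: imset_f.
  by rewrite AE => /imsetP[w wD ->]; exists w.
have gD u : g u \in D by case: (gP u).
have gA u i : g u 0 (f i) = (u *m A) 0 i.
  by case: (gP u) => _ <-; rewrite mxE.
have injg : injective g.
  move=> u v guv; have := @arc_rcode_inj _ _ _ (fun=> 1%g) A arcA kn u v; apply.
  by apply/rowP => i; rewrite !mxE !perm1; have := gA u i; rewrite guv gA !mxE.
have DE : D = [set g u | u : 'rV_k.+1].
  apply/esym/eqP; rewrite eqEcard; apply/andP; split.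
    by apply/subsetP => _ /imsetP[u _ ->].
  by rewrite card_imset // card_mx mul1n cD.
have bP j : exists c : 'cV['F_q]_k.+1 * {perm 'F_q},
    (forall u, g u 0 j = c.2 ((u *m c.1) 0 0)) /\ (forall i, f i = j -> c.1 = col i A).
  have [/codomP[i ->]|jf] := boolP (j \in codom f).
    exists (col i A, 1%g); split=> [u|i' /injf -> //] /=.
    by rewrite perm1 gA !mxE; apply: eq_bigr => e _; rewrite !mxE.
  have [|b [sigma bE]] := @extension_coordinate_linear q k n A (fun u => g u 0 j) q_pr arcA n_big.
    move=> u v uv guv; rewrite -ltnS; have guv' : g u != g v by rewrite (inj_eq injg).
    apply: leq_trans (agreeD _ _ (gD u) (gD v) guv'); rewrite ltnS.
    set X := [set i | _]; have jX : j \notin f @: X.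
      by apply: contra jf => /imsetP[i _ ->]; apply: codom_f.
    have <- : #|j |: f @: X| = #|X|.+1 by rewrite cardsU1 jX card_imset.
    apply/subset_leq_card/subsetP => i; rewrite !inE => /orP[/eqP->|].
      by rewrite guv.
    by case/imsetP=> i'; rewrite inE => /eqP e ->; rewrite !gA e.
  exists (b, sigma); split=> //= i fij; case/negP: jf; rewrite -fij; apply: codom_f.
have {bP} [b bP] := fin_all_exists bP.
exists (\matrix_(e, j) (b j).1 e 0), (fun j => (b j).2), f.
have coordB u j : (u *m \matrix_(e, j) (b j).1 e 0) 0 j = (u *m (b j).1) 0 0.
  by rewrite !mxE; apply: eq_bigr => e _; rewrite !mxE.
split=> //.
- apply/forallP => u; apply/implyP => u0; rewrite -ltnS.
  have gu0 : g u != g 0 by rewrite (inj_eq injg).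
  apply: leq_trans (agreeD _ _ (gD u) (gD 0) gu0); rewrite ltnS.
  apply/subset_leq_card/subsetP => j; rewrite !inE coordB => /eqP uj.
  by rewrite !(bP j).1 uj mul0mx mxE.
- apply/matrixP => e i; rewrite !mxE ((bP (f i)).2 i) // mxE //.
- rewrite DE; apply: eq_imset => u; apply/rowP => j.
  by rewrite (bP j).1 [RHS]mxE coordB.
Qed.

Lemma homo_ord_leq n m (f : 'I_n -> 'I_m) :
  {homo f : i j / (i < j)%N} -> (n <= m)%N.
Proof. by move/homo_ord_inj/leq_card; rewrite !card_ord. Qed.

(** * The maximal extension *)

Lemma largest_arc_extension (F : finFieldType) k n (A : 'M[F]_(k.+1, n)) :
  arc A -> (0 < k)%N -> (k < n)%N ->
  exists m (B : 'M[F]_(k.+1, m)) (f : 'I_n -> 'I_m),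
    [/\ arc B, {homo f : i j / (i < j)%N}, colsub f B = A &
      forall m' (B' : 'M[F]_(k.+1, m')) (f' : 'I_n -> 'I_m'),
        arc B' -> {homo f' : i j / (i < j)%N} -> colsub f' B' = A -> (m' <= m)%N].
Proof.
move=> arcA k0 kn.
pose P m := [exists B : 'M[F]_(k.+1, m), [exists f : {ffun 'I_n -> 'I_m},
  [&& arc B, [forall i : 'I_n, forall j : 'I_n, (i < j)%N ==> (f i < f j)%N] &
      colsub f B == A]]].
have PI m (B : 'M[F]_(k.+1, m)) (f : 'I_n -> 'I_m) :
    arc B -> {homo f : i j / (i < j)%N} -> colsub f B = A -> P m.
  move=> arcB f_mono fB; apply/existsP; exists B; apply/existsP; exists (finfun f).
  apply/and3P; split=> //.
    by apply/forallP => i; apply/forallP => j; rewrite !ffunE; apply/implyP/f_mono.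
  by rewrite -fB; apply/eqP/matrixP => e i; rewrite !mxE ffunE.
have PE m : P m -> exists (B : 'M[F]_(k.+1, m)) (f : 'I_n -> 'I_m),
    [/\ arc B, {homo f : i j / (i < j)%N} & colsub f B = A].
  case/existsP=> B /existsP[f /and3P[arcB f_mono /eqP fB]].
  exists B, f; split=> // i j ij; move/forallP/(_ i)/forallP/(_ j): f_mono.
  by rewrite ij.
have exP : exists m, P m.
  by exists n; apply: (PI n A id) => //; apply/matrixP => i j; rewrite mxE.
have ubP m : P m -> (m <= #|{: 'cV[F]_k.+1}|)%N.
  case/PE=> B [f [arcB f_mono _]]; have nm := homo_ord_leq f_mono.
  rewrite -{1}(card_ord m); apply: (leq_card (fun j => col j B)) => j j' jj'.
  apply/eqP; apply: contraT => /(arc_cols_not_prop 1 arcB k0 (leq_trans kn nm)).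
  by rewrite scale1r jj' eqxx.
case: (ex_maxnP exP ubP) => m /PE[B [f [arcB f_mono fB]]] maxm.
exists m, B, f; split=> // m' B' f' arcB' f'_mono f'B'.
exact: maxm (PI _ _ _ arcB' f'_mono f'B').
Qed.

Lemma natr2_neq0_Fp q : prime q -> odd q -> (2 : 'F_q) != 0.
Proof.
move=> q_pr q_odd; rewrite -(dvdn_pcharf (pchar_Fp q_pr)).
by rewrite dvdn_prime2 //; case: eqP q_odd => // ->.
Qed.

(** Scaling a column by a nonzero constant permutes the alphabet, so it can be
    absorbed in the relabelling. *)
Lemma equivalent_rcode (F : finFieldType) k m (B B' : 'M[F]_(k.+1, m))
    (s : 'S_m) (c : 'I_m -> F) sigma :
  (forall j, c j != 0) -> (forall j, col j B = c j *: col (s j) B') ->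
  equivalent (code B) (rcode sigma B').
Proof.
move=> c0 colB.
have inj_scale j : injective (fun x : F => x / c j).
  by apply: mulIf; rewrite invr_eq0.
pose tau i := (perm (inj_scale ((s^-1)%g i)) * sigma i)%g.
have := equivalent_relabel_all tau
  (equivalent_col_perm (s^-1)%g (equivalent_refl (code B))).
congr (equivalent _ _); rewrite /code -!imset_comp; apply: eq_imset => u.
apply/rowP => i; rewrite [LHS]mxE [RHS]mxE [X in tau i X]mxE permM permE.
congr (sigma i _).
have coordB j : (u *m B) 0 j = c j * (u *m B') 0 (s j).
  rewrite !mxE mulr_sumr; apply: eq_bigr => e _.
  by have /colP/(_ e) := colB j; rewrite !mxE => ->; ring.
by rewrite coordB permKV mulrC mulKf.
Qed.

(** A column that extends the sub-arc [A] extends the whole arc [B], unless it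
    is already in [B] up to a scalar. *)
Lemma missing_column_extends (F : finFieldType) (k n m : nat)
    (A : 'M[F]_(k.+1, n)) (B : 'M[F]_(k.+1, m)) (f : 'I_n -> 'I_m) (a : 'cV[F]_k.+1) :
  (2 : F) != 0 -> (2 * #|F| + 3 * k < 3 * n + 3)%N ->
  arc B -> {homo f : i j / (i < j)%N} -> colsub f B = A ->
  ext_on A setT a -> (forall j c, a != c *: col j B) -> arc (row_mx B a).
Proof.
move=> F2 n_big arcB f_mono fB extA nprop; have injf := homo_ord_inj f_mono.
apply: arc_row_mx => //; apply: (ext_on_setT (I := f @: setT)) => //.
  by rewrite card_imset // cardsT card_ord.
move=> u u0 ua; apply: leq_ltn_trans (extA u u0 ua).
rewrite -(card_imset _ injf); apply/subset_leq_card/subsetP => j.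
rewrite inE => /andP[/imsetP[i _ ->]] Hi; apply: imset_f; move: Hi; rewrite !inE -fB.
suff -> : (u *m colsub f B) 0 i = (u *m B) 0 (f i) by [].
by rewrite !mxE; apply: eq_bigr => e _; rewrite !mxE.
Qed.

Lemma col_ext_on (F : finFieldType) (k n m : nat)
    (A : 'M[F]_(k.+1, n)) (B : 'M[F]_(k.+1, m)) (f : 'I_n -> 'I_m) (j : 'I_m) :
  arc B -> injective f -> colsub f B = A -> j \notin codom f ->
  ext_on A setT (col j B).
Proof.
move=> arcB injf fB jf u u0 uj; rewrite setTI.
apply: leq_trans (arc_zeros arcB u0).
have jX : j \notin f @: zeros A u by apply: contra jf => /imsetP[i _ ->]; apply: codom_f.
have <- : #|j |: f @: zeros A u| = #|zeros A u|.+1 by rewrite cardsU1 jX card_imset.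
apply/subset_leq_card/subsetP => i; rewrite !inE => /orP[/eqP->|/imsetP[i' + ->]].
  by rewrite -uj !mxE; apply/eqP/eq_bigr => e _; rewrite !mxE.
rewrite inE -fB; suff -> : (u *m colsub f B) 0 i' = (u *m B) 0 (f i') by [].
by rewrite !mxE; apply: eq_bigr => e _; rewrite !mxE.
Qed.

Theorem theorem7p12 (q n k : nat) (C : {set 'rV['F_q]_n})
    (q_prime : prime q) (q_odd : odd q)
    (C_mds : is_mds k.+1 C) (C_linear : is_linear k.+1 C)
    (n_large : 2 / 3 * (q%:Q - 1) + k%:Q < n%:Q) :
  (forall (m : nat) (D : {set 'rV['F_q]_m}),
     self_or_extension k.+1 C D -> is_LE k.+1 D) /\
  ((0 < k)%N ->
   exists (m : nat) (M : {set 'rV['F_q]_m}),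
     [/\ self_or_extension k.+1 C M,
         is_maximal k.+1 M &
         forall (m' : nat) (M' : {set 'rV['F_q]_m'}),
           self_or_extension k.+1 C M' -> is_maximal k.+1 M' ->
           equivalent M M']).
Proof.
have q1 := prime_gt1 q_prime.
have n_nat : (2 * q + 3 * k < 3 * n + 2)%N.
  rewrite -(ltr_nat rat) (natrD _ (2 * q)) (natrD _ (3 * n)) !natrM !pmulrn; lra.
have n_big : (2 * q.-1 + 3 * k < 3 * n)%N by clear -n_nat q1; lia.
have n_big' : (2 * #|'F_q| + 3 * k < 3 * n + 3)%N.
  by rewrite (card_Fp q_prime); clear -n_nat; lia.
have kn : (k < n)%N by clear -n_nat q1; lia.
have F2 := natr2_neq0_Fp q_prime q_odd.
have [A CE] := linear_code_matrix C_linear.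
rewrite {C C_linear}CE in C_mds *.
have arcA := arc_of_mds C_mds.
have struct m (D : {set 'rV['F_q]_m}) : self_or_extension k.+1 (code A) D ->
  exists (B : 'M['F_q]_(k.+1, m)) (sigma : 'I_m -> {perm 'F_q}) (f : 'I_n -> 'I_m),
    [/\ arc B, {homo f : i j / (i < j)%N}, colsub f B = A & D = rcode sigma B].
  case=> [|{}m {}D]; last exact: extension_is_rcode.
  exists A, (fun=> 1%g), id; split=> //; last by rewrite rcode1.
  by apply/matrixP => i j; rewrite mxE.
split=> [m D /struct[B [sigma [f [arcB f_mono _ ->]]]]|k0].
  have km : (k < m)%N := leq_trans kn (homo_ord_leq f_mono).
  exists (code B); split; first exact: arc_code_linear.
  have := equivalent_relabel_all (fun j => (sigma j)^-1)%g (equivalent_refl (rcode sigma B)).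
  congr (equivalent _ _); rewrite /rcode -imset_comp; apply: eq_imset => u.
  by apply/rowP => j; rewrite [LHS]mxE [relabel_all _ _ _ _]mxE permK.
have [m [B [f [arcB f_mono fB selfB maxm]]]] :
    exists m (B : 'M['F_q]_(k.+1, m)) (f : 'I_n -> 'I_m),
    [/\ arc B, {homo f : i j / (i < j)%N}, colsub f B = A,
      self_or_extension k.+1 (code A) (code B) &
      forall m' (B' : 'M['F_q]_(k.+1, m')) (f' : 'I_n -> 'I_m'),
        arc B' -> {homo f' : i j / (i < j)%N} -> colsub f' B' = A -> (m' <= m)%N].
  have [m [B [f [arcB f_mono fB maxm]]]] := largest_arc_extension arcA k0 kn.
  have := homo_ord_leq f_mono; rewrite leq_eqVlt => /orP[/eqP nm|nm].
    exists n, A, id; split=> //.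
    - by apply/matrixP => i j; rewrite mxE.
    - exact: soe_self.
    - by move=> m' B' f' arcB' f'_mono f'B'; rewrite nm; apply: maxm f'B'.
  exists m, B, f; split=> //; apply: soe_extension.
  by rewrite -(rcode1 A) -(rcode1 B); apply: extension_rcode f_mono fB _.
have nm := homo_ord_leq f_mono.
have km := leq_trans kn nm.
exists m, (code B); split=> //.
  split; first by rewrite -rcode1; apply: arc_rcode_mds.
  case=> [m' [D extD]].
  have [|B' [sigma [g [arcB' g_mono gB' _]]]] := extension_is_rcode q_prime arcB _ extD.
    by apply: leq_trans n_big _; rewrite leq_mul2l nm orbT.
  have : (m' <= m)%N.
    apply: (maxm _ B' (g \o f)) => //; first by move=> i j ij; apply/g_mono/f_mono.
    by rewrite -fB -gB'; apply/matrixP => i j; rewrite !mxE.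
  by case: extD => mm' _ _ _; rewrite leqNgt mm'.
move=> m' M' /struct[B' [sigma [f' [arcB' f'_mono f'B' ->]]]] [_ M'_max].
have nm' := homo_ord_leq f'_mono.
have km' := leq_trans kn nm'.
have colB j : exists jc : 'I_m' * 'F_q, col j B = jc.2 *: col jc.1 B'.
  have [/codomP[i ->]|jf] := boolP (j \in codom f).
    exists (f' i, 1); rewrite scale1r; apply/colP => e; rewrite !mxE.
    have /matrixP/(_ e i) : colsub f B = colsub f' B' by rewrite fB f'B'.
    by rewrite !mxE.
  have [/existsP[jc /eqP jcE]|] :=
    boolP [exists jc : 'I_m' * 'F_q, col j B == jc.2 *: col jc.1 B'].
    by exists jc.
  rewrite negb_exists => /forallP nprop; case: M'_max.
  exists (m' + 1)%N.
  exists (rcode (fun i => if split i is inl i' then sigma i' else 1%g)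
           (row_mx B' (col j B))).
  apply: (extension_rcode (f := lshift 1)) => //.
  - apply: (missing_column_extends F2 n_big' arcB' f'_mono f'B').
      exact: col_ext_on arcB (homo_ord_inj f_mono) fB jf.
    by move=> i c; apply: (nprop (i, c)).
  - by rewrite addn1.
  - by apply/matrixP => e i; rewrite mxE row_mxEl.
  - by move=> i; rewrite (unsplitK (inl i)).
have {colB} [jc jcE] := fin_all_exists colB.
have m1 : (1 < m)%N by apply: leq_ltn_trans km.
have c0 j : (jc j).2 != 0.
  apply: contraTneq isT => c0.
  have [l jl] : exists l : 'I_m, j != l.
    apply/existsP; apply: contraTT m1; rewrite negb_exists => /forallP H.
    rewrite -leqNgt -[m]card_ord; apply/card_le1_eqP => x y _ _.
    by have /eqP <- := negbNE (H x); have /eqP := negbNE (H y).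
  have := arc_cols_not_prop 0 arcB k0 km jl.
  by rewrite jcE c0 !scale0r eqxx.
have injjc : injective (fun j => (jc j).1).
  move=> j l jl; apply/eqP; apply: contraT => /(arc_cols_not_prop ((jc j).2 / (jc l).2) arcB k0 km).
  by rewrite !jcE jl scalerA divfK // eqxx.
have mm' : (m <= m')%N by have := leq_card _ injjc; rewrite !card_ord.
have {mm'} mE : m' = m by apply/eqP; rewrite eqn_leq mm' (maxm _ B' f').
subst m'.
apply: (equivalent_rcode (s := perm injjc) (c := fun j => (jc j).2)) => // j.
by rewrite permE.
Qed.
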